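(* Let $n\geq 0$ and let $\bar a=(a_0,a_1,\dots,a_n)\in\mathbb{Z}_{+}^{n+1}$ with $a_0\geq 0$, $a_1,\dots,a_{n-1}\geq 1$ and $a_n\geq 2-\delta_{n,0}$. Put $$d=a_0+a_1+\cdots+a_n,\qquad \mu=\tfrac{2}{3}\bigl(4^{d-1}-1\bigr)-\sum_{i=1}^n 4^{a_i+\cdots+a_n-2}.$$ Then for all coprime integers $a,b$ with $\mu a<b<(\mu+1)a$ and every nonnegative integer $M$, $$G\bigl(M,M;b/2^{d-1},(b+1/a)/2^{d-1},2^{d-1}a\bigr)\geq 0.$$
   Context: $\mathbb{Z}_+=\{0,1,2,\dots\}$. The Gaussian polynomial is $\left[\begin{smallmatrix}m+n\\ m\end{smallmatrix}\right]=\prod_{k=1}^m\frac{1-q^{n+k}}{1-q^k}$ if $m,n\in\mathbb{Z}_+$ and $0$ otherwise. For $N,M$ integers, $K$ an integer and $\alpha,\beta$ reals, $$G(N,M;\alpha,\beta,K)=\sum_{j=-\infty}^{\infty}(-1)^j q^{Kj((\alpha+\beta)j+\alpha-\beta)/2}\begin{bmatrix}M+N\\ N-Kj\end{bmatrix}$$ (a finite sum). For such a finite sum $P$ of powers of $q$, $P\geq 0$ means that all its coefficients are nonnegative. *)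

(* Defs.v *)
From HB Require Import structures.
From mathcomp Require Import all_boot all_order all_algebra.
From mathcomp Require Import ring zify.
From mathcomp Require Import monalg.
From mathcomp Require Import classical_sets functions cardinality fsbigop reals.

Set Implicit Arguments.
Unset Strict Implicit.
Unset Printing Implicit Defensive.

Import Order.TTheory GRing.Theory Num.Theory.

Local Open Scope ring_scope.

(* [%/] on {poly int} is pseudo-division in general.  Here the divisor has    *)
(* leading coefficient +1 or -1 and divides exactly (gauss_natK), so this is  *)
(* the true quotient.                                                         *)
Definition gauss_nat (m n : nat) : {poly int} :=
  (\prod_(1 <= k < m.+1) (1 - 'X^(n + k))) %/ (\prod_(1 <= k < m.+1) (1 - 'X^k)).

(* gauss m n is the Gaussian polynomial [m + n choose m]: the second argument *)
(* is n, not the upper entry m + n.                                           *)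
Definition gauss (m n : int) : {poly int} :=
  match m, n with
  | Posz m', Posz n' => gauss_nat m' n'
  | _, _ => 0
  end.

Lemma gauss_nat_dvd (m n : nat) : exists p : {poly int},
  \prod_(1 <= k < m.+1) (1 - 'X^(n + k)) = p * \prod_(1 <= k < m.+1) (1 - 'X^k).
Proof.
elim: n m => [|n IHn] m; first by exists 1; rewrite mul1r.
elim: m => [|m [p1 Hp1]]; first by exists 1; rewrite !big_geq // mul1r.
have [p2 Hp2] := IHn m.+1.
exists (p1 + 'X^(m.+1) * p2).
have shift : (\prod_(1 <= k < m.+1) (1 - 'X^(n.+1 + k))) * (1 - 'X^(n.+1))
    = \prod_(1 <= k < m.+2) (1 - 'X^(n + k)) :> {poly int}.
  rewrite [RHS]big_nat_recl //= addn1 mulrC; congr (_ * _).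
  by apply: eq_bigr => k _; rewrite addnS.
have split : 1 - 'X^(n.+1 + m.+1)
    = (1 - 'X^(m.+1)) + 'X^(m.+1) * (1 - 'X^(n.+1)) :> {poly int}.
  by rewrite exprD; ring.
rewrite big_nat_recr //= split mulrDr [X in _ + X]mulrCA shift Hp2 Hp1.
by rewrite !(@big_nat_recr _ _ _ m.+1) //=; ring.
Qed.

Lemma gauss_natK (m n : nat) :
  gauss_nat m n * \prod_(1 <= k < m.+1) (1 - 'X^k)
  = \prod_(1 <= k < m.+1) (1 - 'X^(n + k)).
Proof.
have [p Hp] := gauss_nat_dvd m n.
rewrite /gauss_nat Hp Pdiv.IdomainUnit.mulpK //.
rewrite lead_coef_prod big_seq rpred_prod // => k.
rewrite mem_index_iota => /andP[k_gt0 _].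
have -> : 1 - 'X^k = - ('X^k - 1%:P) :> {poly int} by rewrite opprB.
by rewrite lead_coefN (monicP (monicXnsubC _ k_gt0)) unitrN1.
Qed.

(* A finite sum of real powers of q with integer coefficients is an element   *)
(* of {malg int[R]}, where q^e is [<< e >>] and [P@_e] is the coefficient of  *)
(* q^e.                                                                       *)
Definition qshift (R : realType) (e : R) (p : {poly int}) : {malg int[R]} :=
  \sum_(i < size p) << p`_i *g e + i%:R >>.

(* For K != 0 only finitely many terms of G are nonzero (gauss_finite), so    *)
(* [\sum_(j \in setT)] is the sum over all integers.                         *)
Lemma gauss_finite (N M K : int) : K != 0 ->
  finite_set [set j : int | gauss (N - K * j) (M + K * j) != 0]%classic.
Proof.
move=> K0; pose B := (absz N + absz M)%N.
apply: (@sub_finite_set _ _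
  ((fun k : nat => k%:Z - B%:Z) @` `I_(B + B).+1)%classic); last first.
  exact/finite_image/finite_II.
move=> j /= nz.
have [h1 h2] : 0 <= N - K * j /\ 0 <= M + K * j.
  by move: nz; case: (N - K * j) (M + K * j) => [?|?] [?|?] //; rewrite eqxx.
have hj : `|j| <= B%:Z.
  have : `|j| <= `|K * j| by rewrite normrM; nia.
  rewrite /B; lia.
exists (absz (j + B%:Z)); first by rewrite /=; lia.
by rewrite /=; lia.
Qed.

Definition G (R : realType) (N M : int) (alpha beta : R) (K : int) :
    {malg int[R]} :=
  \sum_(j \in [set: int])
    (-1) ^ j *: qshift (K%:~R * j%:~R
                         * ((alpha + beta) * j%:~R + alpha - beta) / 2%:R)
                       (gauss (N - K * j) (M + K * j)).

Definition qnonneg (R : realType) (P : {malg int[R]}) : Prop :=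
  forall e : R, 0 <= P@_e.

Definition dsum (n : nat) (a : 'I_n.+1 -> nat) : nat := \sum_i a i.

(* The exponents d - 1 and a_i + ... + a_n - 2 are never truncated when       *)
(* a_n >= 2 - delta_{n,0}.                                                    *)
Definition mu (n : nat) (a : 'I_n.+1 -> nat) : rat :=
  2%:R / 3%:R * (4%:R ^+ (dsum a - 1) - 1)
  - \sum_(i < n.+1 | (0 < i)%N)
      4%:R ^+ ((\sum_(k < n.+1 | (i <= k)%N) a k) - 2).

(* Main.v *)
Require Import Defs.
From mathcomp Require Import all_boot all_order all_algebra.
From mathcomp Require Import reals.
From mathcomp Require Import ring zify.
From mathcomp Require Import monalg.
From mathcomp Require Import classical_sets cardinality fsbigop.

(** The two terms [j] and [- j] of [G] carry the same Gaussian polynomial, and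
    the exponent of [q] is [a b j^2 + j (j - 1) / 2], so that [G] becomes
    [\sum_(j >= 0) kappa j * q^(a b j^2) * [2M, M + 2^(d-1) a j]].

    For [d = 1] positivity for coprime [0 < b < a] comes from the Burge transform,
    which maps the pair [(a, b)] to [(a + b, b)] with nonnegative coefficients and
    multiplies the [j]-th term by [q^(b^2 j^2)].  Together with the symmetry in
    [(a, b)] it reaches every coprime pair from [(1, 1)], where the sum collapses
    because [\sum_j kappa j * [2r, r + j]] vanishes for [r > 0].

    For [c = 1, 2] the polynomial [q^(c r^2) [2L, L - 2r]] is a nonnegative
    combination, independent of [r], of the [[2m, m - r]].  Each use of this
    doubles the period [s] of the sum and adds [c s^2] to the exponent [a b]; and
    the numbers [mu] are exactly the sums [\sum_(k < d - 1) c_k 4^k] with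
    [c_k = 1, 2]. *)

Import Order.TTheory GRing.Theory Num.Theory.
Local Open Scope ring_scope.

(** * Gaussian binomials and Vandermonde sums *)

(** The $q$-Pochhammer symbol $(q;q)_n$. It is nonzero, so identities between Gaussian polynomials
    can be checked by cancelling such factors. *)
Definition qfact (n : nat) : {poly int} := \prod_(1 <= k < n.+1) (1 - 'X^k).

Lemma qfactS n : qfact n.+1 = qfact n * (1 - 'X^(n.+1)).
Proof. by rewrite /qfact big_nat_recr. Qed.

Lemma qfact_neq0 n : qfact n != 0.
Proof.
rewrite /qfact prodf_seq_neq0; apply/allP => k.
rewrite mem_index_iota => /andP[k0 _] /=.
by rewrite -opprB oppr_eq0 monic_neq0 // monicXnsubC.
Qed.

Lemma gauss_qfact m n : gauss_nat m n * qfact m * qfact n = qfact (m + n).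
Proof.
rewrite gauss_natK mulrC [(m + n)%N]addnC.
elim: m => [|m IHm]; first by rewrite addn0 big_geq // mulr1.
by rewrite addnS big_nat_recr //= mulrA IHm qfactS addnS.
Qed.

Lemma gauss0n n : gauss_nat 0 n = 1.
Proof. by rewrite /gauss_nat !big_geq // divp1. Qed.

Lemma gaussC m n : gauss_nat m n = gauss_nat n m.
Proof.
apply: (mulIf (qfact_neq0 m)); apply: (mulIf (qfact_neq0 n)).
by rewrite gauss_qfact mulrAC gauss_qfact addnC.
Qed.

Lemma gauss_pascal m n :
  gauss_nat m.+1 n.+1 = gauss_nat m n.+1 + 'X^(m.+1) * gauss_nat m.+1 n.
Proof.
apply: (mulIf (qfact_neq0 m.+1)); apply: (mulIf (qfact_neq0 n.+1)).
rewrite gauss_qfact !mulrDl.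
have -> : gauss_nat m n.+1 * qfact m.+1 * qfact n.+1
   = (1 - 'X^(m.+1)) * qfact (m + n.+1).
  by rewrite (qfactS m) -gauss_qfact; ring.
have -> : 'X^(m.+1) * gauss_nat m.+1 n * qfact m.+1 * qfact n.+1
   = 'X^(m.+1) * (1 - 'X^(n.+1)) * qfact (m.+1 + n).
  by rewrite (qfactS n) -gauss_qfact; ring.
rewrite addSn qfactS (addSnnS m n) -addSn exprD.
ring.
Qed.

(** Both sides are the $q$-multinomial coefficient with parts [t], [u], [v], [w]. *)
Lemma gauss_multinomial t u v w :
  gauss_nat (t + u) (v + w) * gauss_nat t u * gauss_nat v w
  = gauss_nat (t + u + v) w * gauss_nat t (u + v) * gauss_nat u v.
Proof.
apply: (mulIf (qfact_neq0 t)); apply: (mulIf (qfact_neq0 u)).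
apply: (mulIf (qfact_neq0 v)); apply: (mulIf (qfact_neq0 w)).
transitivity (qfact (t + u + v + w)).
  rewrite -addnA -gauss_qfact -(gauss_qfact t u) -(gauss_qfact v w); ring.
rewrite -gauss_qfact -[(t + u + v)%N]addnA -(gauss_qfact t) -(gauss_qfact u v); ring.
Qed.

(** The guard restores the value 0 for [n < k], where the truncated [n - k] would give 1. *)
Definition qbin (n k : nat) : {poly int} :=
  if (k <= n)%N then gauss_nat k (n - k) else 0.

Lemma qbin_gt n k : (n < k)%N -> qbin n k = 0.
Proof. by rewrite /qbin ltnNge => /negbTE ->. Qed.

Lemma qbinDr m n : qbin (m + n) m = gauss_nat m n.
Proof. by rewrite /qbin leq_addr addKn. Qed.

Lemma qbinDl m n : qbin (m + n) n = gauss_nat m n.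
Proof. by rewrite addnC qbinDr gaussC. Qed.

Lemma qbin0 n : qbin n 0 = 1.
Proof. by rewrite /qbin leq0n gauss0n. Qed.

Lemma qbinn n : qbin n n = 1.
Proof. by rewrite -{1}[n]add0n qbinDl gauss0n. Qed.

Lemma qbin_sub n k : (k <= n)%N -> qbin n (n - k) = qbin n k.
Proof. by move=> /subnKC; move: (n - k)%N => l <-; rewrite qbinDl qbinDr. Qed.

Lemma qbin_pascal n k : qbin n.+1 k.+1 = qbin n k + 'X^(k.+1) * qbin n k.+1.
Proof.
have [lt_nk|lt_kn|->] := ltngtP n k.
- by rewrite !qbin_gt ?mulr0 ?addr0 // leqW.
- rewrite -(subnKC lt_kn); move: (n - k.+1)%N => l.
  have := gauss_pascal k l; rewrite -!qbinDr.
  by rewrite !(addSn, addnS).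
by rewrite !qbinn qbin_gt // mulr0 addr0.
Qed.

Lemma qbin_pascal' n k : (k <= n)%N ->
  qbin n.+1 k.+1 = 'X^(n - k) * qbin n k + qbin n k.+1.
Proof.
move=> le_kn; have [lt_kn|] := ltnP k n; last first.
  move=> le_nk; have -> : k = n by lia.
  by rewrite !qbinn subnn qbin_gt // mulr1 addr0.
rewrite -(subnKC lt_kn); move: (n - k.+1)%N => l.
have := gauss_pascal l k; rewrite ![gauss_nat _ k.+1]gaussC [gauss_nat _ k]gaussC.
have -> : (k.+1 + l - k = l.+1)%N by lia.
by rewrite -!qbinDr addrC !(addSn, addnS).
Qed.

(** Induction on [n] by the second Pascal rule. The exponent [m - (r - k)] is truncated only where
    [qbin m (r - k)] vanishes. *)
Lemma qVandermonde m n r :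
  qbin (m + n) r
  = \sum_(0 <= k < r.+1) 'X^((m - (r - k)) * k) * qbin m (r - k) * qbin n k.
Proof.
elim: n r => [|n IHn] [|r].
- by rewrite big_nat1 !qbin0 muln0 expr0 !mul1r.
- rewrite addn0 big_nat_recl // big1_seq ?addr0; last first.
    by move=> k _; rewrite (@qbin_gt 0) ?mulr0.
  by rewrite subn0 muln0 expr0 mul1r qbin0 mulr1.
- by rewrite big_nat1 !qbin0 muln0 expr0 !mul1r.
have [le_r|lt_r] := leqP r (m + n); last first.
  rewrite qbin_gt ?big1_seq //; last by rewrite addnS ltnS.
  move=> k _; have [?|?] := leqP k n.+1.
    by rewrite (@qbin_gt m) ?mulr0 ?mul0r //; lia.
  by rewrite (@qbin_gt n.+1) ?mulr0.
rewrite addnS qbin_pascal' // !IHn !(@big_nat_recl _ _ _ r.+1) //.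
rewrite !subn0 !muln0 !qbin0 addrCA; congr (_ + _).
rewrite mulr_sumr -big_split; apply: eq_big_nat => k /= le_kr; rewrite subSS.
have [le_kn|] := leqP k n; last first.
  move=> lt_nk; rewrite (@qbin_gt n k) // (@qbin_gt n k.+1) ?leqW //.
  by rewrite (@qbin_gt n.+1 k.+1) // !mulr0 addr0.
rewrite qbin_pascal' // mulrDr; congr (_ + _).
have [le_m|lt_m] := leqP (r - k) m; last by rewrite qbin_gt // !(mul0r, mulr0).
transitivity ('X^(m + n - r + (m - (r - k)) * k) * qbin m (r - k) * qbin n k).
  by rewrite exprD; ring.
have -> : (m + n - r + (m - (r - k)) * k = (m - (r - k)) * k.+1 + (n - k))%N by nia.
by rewrite exprD; ring.
Qed.

Lemma qVandermonde' m n r :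
  qbin (m + n) r
  = \sum_(0 <= k < r.+1) 'X^((n - k) * (r - k)) * qbin m (r - k) * qbin n k.
Proof.
rewrite addnC qVandermonde big_nat_rev; apply: eq_big_nat => k /= le_kr.
by rewrite add0n subSS subKn 1?mulrAC.
Qed.

Lemma eq_big_support (V : nmodType) (F : nat -> V) n m :
  (forall i, (n <= i)%N -> F i = 0) -> (forall i, (m <= i)%N -> F i = 0) ->
  \sum_(0 <= i < n) F i = \sum_(0 <= i < m) F i.
Proof.
move=> Fn Fm; wlog le_nm : n m Fn Fm / (n <= m)%N => [th|].
  by have [?|/ltnW ?] := leqP n m; [apply: th | apply/esym/th].
rewrite [RHS](@big_cat_nat _ _ _ n) //= [X in _ + X]big_nat.
by rewrite [X in _ + X]big1 ?addr0 // => i /andP[? _]; exact: Fn.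
Qed.

(** Passing to complementary lower entries turns the exponent of [qVandermonde] into the quadratic
    $i(i+s)$. *)
Lemma qVandermonde_sym P Q s :
  qbin (P + Q) (P + s)
  = \sum_(0 <= i < P.+1) 'X^(i * (i + s)) * qbin P i * qbin Q (i + s).
Proof.
have [le_sQ|lt_Qs] := leqP s Q; last first.
  rewrite qbin_gt ?ltn_add2l // big1 // => i _.
  by rewrite (@qbin_gt Q) ?mulr0 // ltn_addl.
rewrite -qbin_sub ?leq_add2l // subnDl addnC qVandermonde.
rewrite (@eq_big_support _ _ P.+1 (Q - s).+1) => [|i lt_i|i lt_i]; first last.
- by rewrite (@qbin_gt Q) ?mulr0 //; lia.
- by rewrite (@qbin_gt P) ?mulr0 ?mul0r.
apply: eq_big_nat => i /= le_i.
rewrite -[qbin Q (i + s)]qbin_sub; last by lia.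
rewrite mulrAC; congr ('X^_ * _ * qbin _ _); nia.
Qed.

(** $q$-Vandermonde for [n = (n - i) + i], applied to the second factor only. The variant
    [qbin_mul'] differs in the power of $q$; the two serve the doublings with $c=2$ and $c=1$. *)
Lemma qbin_mul n i j : (i <= n)%N ->
  qbin n i * qbin n j = \sum_(0 <= t < j.+1)
    'X^((i - t) * (j - t)) * (qbin n i * qbin i t * qbin (n - i) (j - t)).
Proof.
move=> le_in; rewrite -{2}(subnK le_in) qVandermonde' mulr_sumr.
by apply: eq_bigr => t _; ring.
Qed.

Lemma qbin_mul' n i j : (i <= n)%N ->
  qbin n i * qbin n j = \sum_(0 <= t < j.+1)
    'X^((n - i - (j - t)) * t) * (qbin n i * qbin i t * qbin (n - i) (j - t)).
Proof.
move=> le_in; rewrite -{2}(subnK le_in) qVandermonde mulr_sumr.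
by apply: eq_bigr => t _; ring.
Qed.

(** With [i = u + t], both sides are the sum over the triangle [u + t < n]. *)
Lemma big_antidiagonal (V : nmodType) (F : nat -> nat -> V) n :
  (forall u t, (n <= u + t)%N -> F u t = 0) ->
  \sum_(0 <= i < n) \sum_(0 <= t < i.+1) F (i - t)%N t
  = \sum_(0 <= u < n) \sum_(0 <= t < n) F u t.
Proof.
move=> F0; transitivity (\sum_(0 <= u < n) \sum_(0 <= t < n - u) F u t).
  elim: {-2}n (leqnn n) => [|m IHm] lt_mn; first by rewrite !big_geq.
  rewrite big_nat_recr //= IHm ?(ltnW lt_mn) //.
  rewrite [RHS]big_nat_recr //= subSnn big_nat1.
  have -> : \sum_(0 <= u < m) \sum_(0 <= t < m.+1 - u) F u t
     = \sum_(0 <= u < m) (\sum_(0 <= t < m - u) F u t + F u (m - u)%N).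
    by apply: eq_big_nat => u /= lt_um; rewrite subSn 1?ltnW // big_nat_recr.
  rewrite big_split /= -addrA; congr (_ + _).
  rewrite big_nat_rev /= add0n big_nat_recr //=.
  rewrite !subnn subn0; congr (_ + _); apply: eq_big_nat => i /= lt_im.
  by rewrite subSS subKn // ltnW.
apply: eq_big_nat => u /= lt_un; apply: eq_big_support => t ?; apply: F0; lia.
Qed.

Lemma qbin_revision n j k :
  qbin n j * qbin (n - j) k = qbin (k + j) k * qbin n (k + j).
Proof.
have [le_kj|lt_kj] := leqP (k + j) n; last first.
  rewrite [RHS]mulrC (@qbin_gt n (k + j)) // mul0r.
  have [le_jn|?] := leqP j n; last by rewrite qbin_gt ?mul0r.
  by rewrite (@qbin_gt (n - j)) ?mulr0 //; lia.
rewrite -(subnKC le_kj); move: (n - (k + j))%N => l.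
have := gauss_multinomial 0 j k l; rewrite !add0n !gauss0n !mulr1.
have -> : (k + j + l - j = k + l)%N by lia.
have -> : qbin (k + j + l) j = gauss_nat j (k + l).
  by rewrite -qbinDr; congr qbin; lia.
by rewrite !qbinDr => ->; rewrite [(j + k)%N]addnC [gauss_nat j k]gaussC mulrC.
Qed.

(** The $q$-Pfaff-Saalschutz sum as a polynomial identity. Expanding the first factor by
    $q$-Vandermonde gives a double sum; a second $q$-Vandermonde sums each antidiagonal, and a third
    sums over the antidiagonals. *)
Lemma qSaalschutz N P Q c :
  \sum_(0 <= i < N.+1) 'X^(i * (i + c)) *
     (qbin (N + P + Q - i) (P + Q) * qbin P i * qbin Q (i + c))
  = qbin (N + P + c) N * qbin (N + Q) (N + c).
Proof.
pose F u t : {poly int} :=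
  'X^(t * (t + c) + u * (P + c + u + t)) * (qbin P t * qbin (u + t + c) u *
     (qbin Q (u + t + c) * qbin (N + P + c) (N - (u + t)))).
(* The new factor [qbin (Q - i - c) k] is absorbed into [qbin Q (i + c)] by trinomial revision,
   after which [Q] meets only [i + k]. *)
have stepL i : (i <= N)%N ->
  'X^(i * (i + c)) *
     (qbin (N + P + Q - i) (P + Q) * qbin P i * qbin Q (i + c))
  = \sum_(0 <= k < N.+1) (if (i + k <= N)%N then F k i else 0).
  move=> le_iN; have [le_icQ|] := leqP (i + c) Q; last first.
    move=> lt_Q; rewrite (@qbin_gt Q) // !mulr0 big1 // => k _; case: ifP => // _.
    by rewrite /F (@qbin_gt Q) ?(mul0r, mulr0) // -addnA ltn_addl.
  rewrite -qbin_sub; last by lia.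
  have -> : (N + P + Q - i - (P + Q) = N - i)%N by lia.
  have -> : (N + P + Q - i = N + P + c + (Q - i - c))%N by lia.
  rewrite qVandermonde !mulr_suml mulr_sumr.
  rewrite [RHS](@eq_big_support _ _ _ (N - i).+1).
  - apply: eq_big_nat => k /= le_k; rewrite ifT; last by lia.
    rewrite /F.
    have -> : (N + P + c - (N - i - k) = P + c + k + i)%N by lia.
    have -> : (N - i - k = N - (k + i))%N by lia.
    have [le_kQ|lt_kQ] := leqP k (Q - i - c); last first.
      rewrite (@qbin_gt (Q - i - c)) // (@qbin_gt Q (k + i + c)); last by lia.
      by rewrite !(mulr0, mul0r).
    have E : qbin Q (i + c) * qbin (Q - i - c) k
             = qbin (k + i + c) k * qbin Q (k + i + c).
      have := qbin_revision Q (i + c) k.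
      by rewrite subnDA addnA.
    rewrite exprD -[RHS]mulrA; rewrite [(k * _)%N]mulnC.
    transitivity ('X^(i * (i + c)) * 'X^((P + c + k + i) * k) * qbin P i *
      qbin (N + P + c) (N - (k + i)) * (qbin Q (i + c) * qbin (Q - i - c) k)).
      by ring.
    by rewrite E; ring.
  - by move=> k lt_k; rewrite ifF //; lia.
  - by move=> k lt_k; rewrite ifF //; lia.
rewrite (eq_big_nat _ _ (fun i (lt_i : (0 <= i < N.+1)%N) => stepL i lt_i)).
rewrite exchange_big_nat /=.
pose F' u t := if (u + t <= N)%N then F u t else 0.
transitivity (\sum_(0 <= u < N.+1) \sum_(0 <= t < N.+1) F' u t).
  by apply: eq_bigr => u _; apply: eq_bigr => t _; rewrite /F' addnC.
rewrite -big_antidiagonal => [|u t lt_N]; last by rewrite /F' ifF //; lia.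
rewrite qVandermonde_sym mulr_sumr; apply: eq_big_nat => s /= le_sN.
(* On the antidiagonal [u + t = s], apart from a power of $q$, only [qbin P t] and
   [qbin (s + c) (s - t)] depend on [t]. *)
transitivity ('X^(s * (s + c)) * (qbin Q (s + c) * qbin (N + P + c) (N - s)) *
   qbin (s + c + P) s).
  rewrite (qVandermonde' (s + c)) mulr_sumr; apply: eq_big_nat => t /= le_ts.
  rewrite /F' ifT /F; last by lia.
  rewrite subnK //.
  have [le_tP|?] := leqP t P; last by rewrite (@qbin_gt P) ?(mul0r, mulr0).
  have -> : (t * (t + c) + (s - t) * (P + c + (s - t) + t)
            = s * (s + c) + (P - t) * (s - t))%N by nia.
  by rewrite exprD; ring.
have := qbin_revision (N + P + c) (N - s) s.
have -> : (N + P + c - (N - s) = s + c + P)%N by lia.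
rewrite subnKC // => E; rewrite -!mulrA E; ring.
Qed.

(** * The Burge transform *)

(** The product of $[L+M+a-b,\,L+a]$ and $[L+M-a+b,\,L-a]$; the guard gives 0 where [L - a] or
    [M - b] would be negative. *)
Definition burge (L M a b : nat) : {poly int} :=
  if (a <= L)%N && (b <= M)%N
  then gauss_nat (L + a) (M - b) * gauss_nat (L - a) (M + b) else 0.

Lemma burge_eq0 L M a b : ~~ ((a <= L)%N && (b <= M)%N) -> burge L M a b = 0.
Proof. by rewrite /burge => /negbTE ->. Qed.

Lemma burgeC L M a b : burge L M a b = burge M L b a.
Proof.
rewrite /burge andbC; case: ifP => // _.
by rewrite mulrC [gauss_nat (L - a) _]gaussC [gauss_nat (L + a) _]gaussC.
Qed.

(** The terms with [i < b] vanish, and the shift by [b] splits off $q^{b^2}$. The free weight [w]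
    serves both forms of the Burge transform. *)
Lemma burge_sum (w : nat -> {poly int}) L a b : (a + b <= L)%N ->
  \sum_(0 <= i < L.+1) 'X^(i ^ 2) * (w i * burge (L - i) i a b)
  = 'X^(b ^ 2) * \sum_(0 <= i < (L - b).+1) 'X^(i * (i + b.*2)) *
      (w (i + b)%N * qbin (L + a - b) i * qbin (L - a + b) (i + b.*2)).
Proof.
move=> le_abL; rewrite (@big_cat_nat _ _ _ b) //=; last by lia.
rewrite [X in X + _]big_nat [X in X + _]big1 => [|i /= lt_ib]; last first.
  by rewrite burge_eq0 ?mulr0 //; lia.
rewrite add0r -{1}[b]add0n big_addn subSn; last by lia.
rewrite mulr_sumr; apply: eq_big_nat => i /= le_i.
have -> : ((i + b) ^ 2 = b ^ 2 + i * (i + b.*2))%N by nia.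
rewrite exprD -!mulrA; congr (_ * (_ * (_ * _))).
have [le_iL|lt_iL] := leqP (i + a + b) L; last first.
  by rewrite burge_eq0 ?(@qbin_gt (L - a + b)) ?mulr0 //; lia.
rewrite /burge ifT; last by lia.
rewrite -2!qbinDl addnK; congr (qbin _ _ * _); first lia.
by congr qbin; lia.
Qed.

Lemma burge_sum_eq0 (w : nat -> {poly int}) L a b : (L < a + b)%N ->
  \sum_(0 <= i < L.+1) 'X^(i ^ 2) * (w i * burge (L - i) i a b) = 0.
Proof.
by move=> lt_L; rewrite big_nat big1 // => i ?; rewrite burge_eq0 ?mulr0 //; lia.
Qed.

(** The weights depend on neither [a] nor [b], so one expansion serves all terms of an alternating
    sum. After [burge_sum] this is [qSaalschutz] with $N=M-b$, $P=L+a-b$, $Q=L-a+b$, $c=2b$. *)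
Lemma burge_transform L M a b :
  'X^(b ^ 2) * burge L M (a + b) b
  = \sum_(0 <= i < L.+1)
      'X^(i ^ 2) * (qbin (L.*2 + M - i) L.*2 * burge (L - i) i a b).
Proof.
pose w i := qbin (L.*2 + M - i) L.*2.
have [le_abL|lt_L] := leqP (a + b) L; last first.
  by rewrite burge_sum_eq0 // burge_eq0 ?mulr0 //; lia.
have [le_bM|lt_Mb] := leqP b M; last first.
  rewrite burge_eq0 ?mulr0 ?[RHS]big_nat ?[RHS]big1 //; last by lia.
  move=> i /andP[_ lt_iL]; have [?|?] := leqP b i.
    by rewrite qbin_gt ?(mul0r, mulr0) //; lia.
  by rewrite burge_eq0 ?mulr0 //; lia.
rewrite [RHS](burge_sum w) // /w; congr (_ * _).
have EP : (M - b + (L + a - b) + (L - a + b) = L.*2 + M - b)%N by lia.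
have EQ : ((L + a - b) + (L - a + b) = L.*2)%N by lia.
have := qSaalschutz (M - b) (L + a - b) (L - a + b) b.*2.
rewrite EP EQ.
have -> : (M - b + (L + a - b) + b.*2 = (L + a + b) + (M - b))%N by lia.
have -> : (M - b + (L - a + b) = (L - (a + b)) + (M + b))%N by lia.
have -> : (M - b + b.*2 = M + b)%N by lia.
rewrite !qbinDl /burge ifT; last by lia.
rewrite addnA => <-; rewrite (@eq_big_support _ _ _ (L - b).+1).
- apply: eq_bigr => i _.
  have -> : (L.*2 + M - b - i = L.*2 + M - (i + b))%N by lia.
  by [].
(* For [i > M - b] the upper entry is below $2L$, except when [L = 0]: then truncation makes the
   factor 1, and the factor with upper entry $P=0$ vanishes instead. *)
- move=> i lt_i; have [?|L0] := posnP L; last first.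
    by rewrite qbin_gt ?(mul0r, mulr0) //; lia.
  by rewrite (@qbin_gt (L + a - b)) ?(mul0r, mulr0) //; lia.
move=> i lt_i; rewrite (@qbin_gt (L - a + b)) ?(mul0r, mulr0) //; lia.
Qed.

(** The limit of [burge_transform] as $M\to\infty$, multiplied by $(q;q)_{2L}$; the Saalschutz sum
    becomes a $q$-Vandermonde sum. *)
Lemma burge_transform_lim L a b :
  'X^(b ^ 2) * qbin L.*2 (L + (a + b))
  = \sum_(0 <= i < L.+1) 'X^(i ^ 2) * burge (L - i) i a b.
Proof.
transitivity (\sum_(0 <= i < L.+1) 'X^(i ^ 2) * (1 * burge (L - i) i a b));
  last first.
  by apply: eq_bigr => i _; rewrite mul1r.
have [le_abL|lt_L] := leqP (a + b) L; last first.
  by rewrite (burge_sum_eq0 (fun=> 1)) // qbin_gt ?mulr0 //; lia.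
rewrite (burge_sum (fun=> 1)) //.
congr (_ * _); have := qVandermonde_sym (L + a - b) (L - a + b) b.*2.
have -> : ((L + a - b) + (L - a + b) = L.*2)%N by lia.
have -> : (L + a - b + b.*2 = L + (a + b))%N by lia.
move=> ->; rewrite (@eq_big_support _ _ _ (L - b).+1).
- by apply: eq_bigr => i _; ring.
- by move=> i lt_i; rewrite (@qbin_gt (L + a - b)) ?(mul0r, mulr0).
move=> i lt_i; rewrite (@qbin_gt (L - a + b)) ?(mul0r, mulr0) //; lia.
Qed.

(** * Expansions in central Gaussian polynomials *)

Lemma qbin_multinomial n t u v :
  qbin n (t + u) * qbin (t + u) t * qbin (n - (t + u)) v
  = qbin n (t + u + v) * qbin (t + u + v) (u + v) * qbin (u + v) v.
Proof.
have [le_n|lt_n] := leqP (t + u + v) n; last first.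
  rewrite (@qbin_gt n (t + u + v)) // !mul0r.
  have [?|?] := leqP (t + u) n; last by rewrite qbin_gt ?mul0r.
  by rewrite (@qbin_gt (n - _)) ?mulr0 //; lia.
rewrite -(subnKC le_n); move: (n - (t + u + v))%N => w.
have := gauss_multinomial t u v w.
rewrite -!qbinDr [qbin (_ + (u + v)) t]qbinDr -qbinDl [qbin (u + v) u]qbinDr -qbinDl.
have -> : (t + u + v + w - (t + u) = v + w)%N by lia.
by rewrite !addnA.
Qed.

(** On the diagonal both factors have upper entry [L + M]. Linearizing their product, with
    [r = L - t], leaves [j] only in the central factor [qbin r.*2 (r + j)]. *)
Lemma burge_diag L M j :
  'X^(j ^ 2) * burge L M j j
  = \sum_(0 <= r < L.+1) 'X^(r ^ 2) *
      (qbin (L + M) (L + r) * qbin (L + r) r.*2) * qbin r.*2 (r + j).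
Proof.
have small r : (r < j)%N -> qbin r.*2 (r + j) = 0.
  by move=> lt_rj; rewrite qbin_gt //; lia.
have [/andP[le_jL le_jM]|no] := boolP ((j <= L)%N && (j <= M)%N); last first.
  rewrite burge_eq0 // mulr0 [RHS]big_nat [RHS]big1 // => r lt_r.
  have [?|?] := ltnP r j; first by rewrite small // mulr0.
  by rewrite (@qbin_gt (L + M)) ?(mul0r, mulr0) //; lia.
rewrite /burge le_jL le_jM /= -2!qbinDr mulrC.
have -> : (L + j + (M - j) = L + M)%N by lia.
have -> : (L - j + (M + j) = L + M)%N by lia.
rewrite [qbin _ (L + j) * _]mulrC qbin_mul; last by lia.
rewrite (@eq_big_support _ _ _ L.+1); first last.
- by move=> t ?; rewrite (@qbin_gt (L - j)) ?(mul0r, mulr0) //; lia.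
- by move=> t ?; rewrite (@qbin_gt (L - j)) ?(mul0r, mulr0) //; lia.
rewrite big_nat_rev mulr_suml; apply: eq_big_nat => r /= le_rL.
rewrite add0n subSS.
have [lt_rj|le_jr] := ltnP r j.
  rewrite small // (@qbin_gt (L - j)) ?(mul0r, mulr0) //; lia.
have -> : (r ^ 2 = j ^ 2 + (r - j) * (r + j))%N by nia.
have -> : (L - j - (L - r) = r - j)%N by lia.
have -> : (L + j - (L - r) = r + j)%N by lia.
have -> : (L + M - (L - j) = M + j)%N by lia.
have [le_rM|lt_Mr] := leqP r M; last first.
  by rewrite (@qbin_gt (M + j)) ?(@qbin_gt (L + M) (L + r)) ?(mul0r, mulr0) //; lia.
have := qbin_multinomial (L + M) (L - r) (r - j) (r + j).
have -> : (L - r + (r - j) = L - j)%N by lia.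
have -> : (L - j + (r + j) = L + r)%N by lia.
have -> : (r - j + (r + j) = r.*2)%N by lia.
have -> : (L + M - (L - j) = M + j)%N by lia.
by rewrite exprD => E; rewrite -[RHS]mulrA -E; ring.
Qed.

(* [f] and [e] are the exponents of an expansion of [qbin L i * qbin L j] and *)
(* of the resulting connection coefficients; both choices [c = 1, 2] fit.     *)
Lemma qbin_double (c L r : nat) (f e : nat -> nat -> nat) :
  (forall i, (i <= L)%N -> qbin L i * qbin L (i + r.*2)
     = \sum_(0 <= t < (i + r.*2).+1)
        'X^(f i t) * (qbin L i * qbin i t * qbin (L - i) (i + r.*2 - t))) ->
  (forall u t, (t + (u + r).*2 <= L)%N ->
     c * r ^ 2 + (u + t) * (u + t + r.*2) + f (u + t) t = e (u + r) t)%N ->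
  'X^(c * r ^ 2) * qbin L.*2 (L + r.*2)
  = \sum_(0 <= m < L.+1) (\sum_(0 <= t < L.+1)
      'X^(e m t) * qbin L (t + m.*2) * qbin (t + m.*2) m.*2) * qbin m.*2 (m + r).
Proof.
move=> Hf He; pose H m := (\sum_(0 <= t < L.+1)
  'X^(e m t) * qbin L (t + m.*2) * qbin (t + m.*2) m.*2) * qbin m.*2 (m + r).
have -> : \sum_(0 <= m < L.+1) H m = \sum_(0 <= u < L.+1) H (u + r)%N.
  rewrite (@eq_big_support _ _ L.+1 (r + L.+1)); first last.
  - move=> m lt_m; rewrite /H big1 ?mul0r // => t _.
    by rewrite (@qbin_gt L) ?(mul0r, mulr0) //; lia.
  - move=> m lt_m; rewrite /H big1 ?mul0r // => t _.
    by rewrite (@qbin_gt L) ?(mul0r, mulr0) //; lia.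
  rewrite (@big_cat_nat _ _ _ r) ?leq_addr //= big_nat big1 ?add0r.
    by rewrite -{1}[r]add0n big_addn addKn.
  by move=> m ?; rewrite /H (@qbin_gt m.*2) ?mulr0 //; lia.
(* The summand after $q$-Vandermonde over [i = u + t] and linearization over [t]. The index of the
   resulting central polynomial is [m = u + r]. *)
pose F u t : {poly int} := 'X^((u + t) * (u + t + r.*2) + f (u + t)%N t) *
  (qbin L (u + t) * qbin (u + t) t * qbin (L - (u + t)) (u + r.*2)).
transitivity ('X^(c * r ^ 2) * \sum_(0 <= u < L.+1) \sum_(0 <= t < L.+1) F u t).
  congr (_ * _); rewrite -big_antidiagonal; last first.
    by move=> u t lt_L; rewrite /F (@qbin_gt L) ?(mul0r, mulr0).
  rewrite -addnn qVandermonde_sym; apply: eq_big_nat => i /= le_iL.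
  rewrite -mulrA Hf // mulr_sumr (@eq_big_support _ _ _ i.+1).
  - apply: eq_big_nat => t /= le_ti; rewrite /F subnK //.
    have -> : (i - t + r.*2 = i + r.*2 - t)%N by lia.
    by rewrite exprD mulrA.
  - by move=> t ?; rewrite (@qbin_gt i) ?(mul0r, mulr0) //; lia.
  - by move=> t ?; rewrite (@qbin_gt i) ?(mul0r, mulr0).
rewrite mulr_sumr; apply: eq_bigr => u _.
rewrite /H mulr_sumr mulr_suml; apply: eq_bigr => t _.
have := qbin_multinomial L t u (u + r.*2).
have -> : (t + u + (u + r.*2) = t + (u + r).*2)%N by lia.
have -> : (u + (u + r.*2) = (u + r).*2)%N by lia.
have -> : (u + r + r = u + r.*2)%N by lia.
have [le_L E|lt_L E] := leqP (t + (u + r).*2) L.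
  rewrite -He // !exprD /F -!mulrA [qbin L (t + _) * _]mulrA -E.
  by rewrite exprD [(t + u)%N]addnC; ring.
rewrite /F [(u + t)%N]addnC E (@qbin_gt L) // !(mul0r, mulr0) //.
Qed.

Lemma qbin_double1 L r :
  'X^(r ^ 2) * qbin L.*2 (L + r.*2)
  = \sum_(0 <= m < L.+1) (\sum_(0 <= t < L.+1)
      'X^(m ^ 2 + L * t) * qbin L (t + m.*2) * qbin (t + m.*2) m.*2) *
      qbin m.*2 (m + r).
Proof.
rewrite -{1}[(r ^ 2)%N]mul1n.
apply: (@qbin_double 1 L r (fun i t => (L - i - (i + r.*2 - t)) * t)%N
  (fun m t => m ^ 2 + L * t)%N).
  by move=> i le_iL; exact: qbin_mul'.
move=> u t le_L.
have [l ->] : exists l, L = (t + (u + r).*2 + l)%N.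
  by exists (L - (t + (u + r).*2))%N; lia.
have -> : (t + (u + r).*2 + l - (u + t) - (u + t + r.*2 - t) = l)%N by lia.
nia.
Qed.

Lemma qbin_double2 L r :
  'X^(2 * r ^ 2) * qbin L.*2 (L + r.*2)
  = \sum_(0 <= m < L.+1) (\sum_(0 <= t < L.+1)
      'X^(t ^ 2 + 2 * t * m + 2 * m ^ 2) * qbin L (t + m.*2) *
      qbin (t + m.*2) m.*2) * qbin m.*2 (m + r).
Proof.
apply: (@qbin_double 2 L r (fun i t => (i - t) * (i + r.*2 - t))%N
  (fun m t => t ^ 2 + 2 * t * m + 2 * m ^ 2)%N).
  by move=> i le_iL; exact: qbin_mul.
move=> u t _; rewrite addnK.
have -> : (u + t + r.*2 - t = u + r.*2)%N by lia.
nia.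
Qed.

(** * Positivity *)

Definition poly_nneg (p : {poly int}) : Prop := forall i, 0 <= p`_i.

Lemma poly_nnegXn n : poly_nneg 'X^n.
Proof. by move=> i; rewrite coefXn ler0n. Qed.

Lemma poly_nneg_nat n : poly_nneg n%:R.
Proof. by move=> i; rewrite coefMn coef1 mulrn_wge0 // ler0n. Qed.

Lemma poly_nnegD p q : poly_nneg p -> poly_nneg q -> poly_nneg (p + q).
Proof. by move=> p0 q0 i; rewrite coefD addr_ge0. Qed.

Lemma poly_nnegM p q : poly_nneg p -> poly_nneg q -> poly_nneg (p * q).
Proof. by move=> p0 q0 i; rewrite coefM sumr_ge0 // => k _; rewrite mulr_ge0. Qed.

Lemma poly_nneg_sum n (F : nat -> {poly int}) :
  (forall i, (i < n)%N -> poly_nneg (F i)) -> poly_nneg (\sum_(0 <= i < n) F i).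
Proof.
move=> F0 k; rewrite coef_sum big_nat sumr_ge0 // => i /andP[_ lt_in].
exact: F0.
Qed.

Lemma qbin_nneg n k : poly_nneg (qbin n k).
Proof.
elim: n k => [|n IHn] [|k]; rewrite ?qbin0; try exact: (poly_nneg_nat 1).
  by rewrite qbin_gt //; exact: (poly_nneg_nat 0).
by rewrite qbin_pascal; apply: poly_nnegD; [|apply: poly_nnegM (poly_nnegXn _) _].
Qed.

(* The factors (-1)^j q^(j(j-1)/2) of the terms [j] and [- j] of G, added up. *)
Definition kappa (j : nat) : {poly int} :=
  if j == 0%N then 1 else (-1) ^+ j * 'X^('C(j, 2)) * (1 + 'X^j).

(** The folded form of [G], with [c] for $ab$. The cut-off [B] is a separate parameter, so it stays
    fixed while the other bounds shrink in an expansion. *)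
Definition theta (c B : nat) (E : nat -> {poly int}) : {poly int} :=
  \sum_(0 <= j < B.+1) kappa j * 'X^(c * j ^ 2) * E j.

(** The weights [W] do not depend on [j], so the sums can be exchanged. Each positivity step below
    is an instance with nonnegative [W]. *)
Lemma theta_sum c1 c2 B n (E : nat -> {poly int}) (W : nat -> {poly int}) F :
  (forall j, 'X^(c2 * j ^ 2) * E j = \sum_(0 <= i < n) W i * F i j) ->
  theta (c1 + c2) B E = \sum_(0 <= i < n) W i * theta c1 B (F i).
Proof.
move=> HE; rewrite /theta.
under [RHS]eq_bigr => i _ do rewrite mulr_sumr.
rewrite exchange_big_nat /=; apply: eq_bigr => j _.
rewrite mulnDl exprD -!mulrA HE !mulr_sumr; apply: eq_bigr => i _; ring.
Qed.

(** For [r > 0] the partial sums have the closed form [partial], whose Gaussian polynomial vanishes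
    once [r <= J]. *)
Lemma kappa_sum r B : (r <= B)%N ->
  \sum_(0 <= j < B.+1) kappa j * qbin r.*2 (r + j) = (r == 0)%:R.
Proof.
case: r => [_|s le_sB].
  rewrite big_nat_recl // big1 ?addr0 ?qbin0 ?mulr1 // => j _.
  by rewrite qbin_gt ?mulr0.
have partial J : \sum_(0 <= j < J.+1) kappa j * qbin s.+1.*2 (s.+1 + j)
    = (1 + 'X^(s.+1)) * (-1) ^+ J * 'X^('C(J.+1, 2)) * qbin s.*2.+1 (s.+1 + J).
  elim: J => [|J IHJ].
    rewrite big_nat1 /kappa eqxx mul1r addn0 bin_small // expr0 !mulr1.
    rewrite doubleS qbin_pascal mulrDl mul1r; congr (_ + _).
    by rewrite -qbin_sub; [congr qbin|]; lia.
  rewrite big_nat_recr //= IHJ /kappa /= [in X in _ = _ * X * _]binS bin1 exprD.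
  rewrite [(-1) ^+ _.+1]exprS doubleS !addnS !addSn.
  have [le_Js|lt_sJ] := leqP J s; last first.
    by rewrite !(@qbin_gt _ _.+1) ?mulr0 ?addr0 //; lia.
  have E1 := qbin_pascal s.*2.+1 (s + J).+1.
  have E2 : qbin s.*2.+2 (s + J).+2
    = 'X^(s - J) * qbin s.*2.+1 (s + J).+1 + qbin s.*2.+1 (s + J).+2.
    by rewrite qbin_pascal'; [congr ('X^_ * _ + _)|]; lia.
  move: E1 E2; set P := qbin _ (s + J).+1; set Q := qbin s.*2.+1 (s + J).+2.
  set T := qbin s.*2.+2 _ => E1 E2.
  (* The first Pascal rule for [T] plus $q^{J+1}$ times the second. *)
  have E : (1 + 'X^(J.+1)) * T = (1 + 'X^(s.+1)) * (P + 'X^(J.+1) * Q).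
    rewrite mulrDl mul1r {1}E1 E2.
    have -> : 'X^((s + J).+2) = 'X^(s.+1) * 'X^(J.+1) :> {poly int}.
      by rewrite -exprD; congr ('X^_); lia.
    have -> : 'X^(s.+1) = 'X^(J.+1) * 'X^(s - J) :> {poly int}.
      by rewrite -exprD; congr ('X^_); lia.
    ring.
  transitivity ((-1) ^+ J * 'X^('C(J.+1, 2)) *
      ((1 + 'X^(s.+1)) * P - (1 + 'X^(J.+1)) * T)).
    by ring.
  by rewrite E; ring.
rewrite partial (@qbin_gt _ (s.+1 + B)) ?mulr0 //; lia.
Qed.

(** The bound on [B] is symmetric in [L] and [M], and it passes to the pairs [(L - i, i)] of the
    Burge transform. *)
Definition burge_pos (c a b : nat) : Prop := forall L M B : nat,
  (L + M <= B)%N -> poly_nneg (theta c B (fun j => burge L M (a * j) (b * j))).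

Definition central_pos (c s : nat) : Prop := forall L B : nat,
  (L <= B)%N -> poly_nneg (theta c B (fun j => qbin L.*2 (L + s * j))).

(** By [burge_diag] this is a nonnegative combination of the sums in [kappa_sum], of which only
    [r = 0] survives. *)
Lemma burge_pos11 : burge_pos 1 1 1.
Proof.
move=> L M B le_B; rewrite -[1%N]add0n.
rewrite (@theta_sum _ _ _ L.+1 _ (fun r => 'X^(r ^ 2) *
  (qbin (L + M) (L + r) * qbin (L + r) r.*2)) (fun r j => qbin r.*2 (r + j))).
  apply: poly_nneg_sum => r lt_rL.
  do ![apply: poly_nnegM]; try (exact: poly_nnegXn || exact: qbin_nneg).
  rewrite /theta; under eq_bigr => j _ do rewrite mul0n mulr1.
  by rewrite kappa_sum; [exact: poly_nneg_nat | lia].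
by move=> j; rewrite add0n !mul1n burge_diag.
Qed.

Lemma burge_posC c a b : burge_pos c a b -> burge_pos c b a.
Proof.
move=> pos L M B le_B; rewrite /theta.
under eq_bigr => j _ do rewrite burgeC.
by apply: pos; rewrite addnC.
Qed.

(** The transform at [(a * j, b * j)] contributes $q^{b^2j^2}$; for $c=ab$ the new exponent is
    $(a+b)b$. *)
Lemma burge_posD c a b : burge_pos c a b -> burge_pos (c + b ^ 2) (a + b) b.
Proof.
move=> pos L M B le_B.
rewrite (@theta_sum _ _ _ L.+1 _ (fun i => 'X^(i ^ 2) * qbin (L.*2 + M - i) L.*2)
  (fun i j => burge (L - i) i (a * j) (b * j))).
  apply: poly_nneg_sum => i lt_iL; apply: poly_nnegM; last by apply: pos; lia.
  by apply: poly_nnegM; [exact: poly_nnegXn | exact: qbin_nneg].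
move=> j; rewrite -expnMn mulnDl burge_transform.
by apply: eq_bigr => i _; rewrite mulrA.
Qed.

Lemma coprime_subl a b : (b <= a)%N -> coprime (a - b) b = coprime a b.
Proof.
by move=> le_ba; rewrite ![coprime _ b]coprime_sym /coprime -(gcdnDr b) subnK.
Qed.

(** The subtractive Euclidean algorithm run backwards from [(1, 1)], by induction on a bound for
    [a + b]. *)
Lemma burge_pos_coprime a b : (0 < a)%N -> (0 < b)%N -> coprime a b ->
  burge_pos (a * b) a b.
Proof.
elim: {a b}(a + b)%N {-2}a {-2}b (leqnn (a + b)) => [|n IHn] a b; first by lia.
wlog lt_ba : a b / (b < a)%N => [th|].
  have [|lt_ab le_n a0 b0 co|->] := ltngtP b a; first exact: th.
    by rewrite mulnC; apply/burge_posC/th; rewrite 1?coprime_sym 1?addnC.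
  by rewrite /coprime gcdnn => _ _ _ /eqP ->; exact: burge_pos11.
move=> le_n a0 b0 co; rewrite -{2}(subnK (ltnW lt_ba)).
have -> : (a * b = (a - b) * b + b ^ 2)%N by nia.
apply: burge_posD; apply: IHn => //; [lia|lia|].
by rewrite coprime_subl // ltnW.
Qed.

(** One more Burge step, from [(a - b, b)], now with the limiting transform, which yields a single
    central polynomial instead of a product. *)
Lemma central_pos_base a b : (0 < b < a)%N -> coprime a b ->
  central_pos (a * b) a.
Proof.
move=> /andP[b0 lt_ba] co L B le_LB.
have -> : (a * b = (a - b) * b + b ^ 2)%N by nia.
rewrite (@theta_sum _ _ _ L.+1 _ (fun i => 'X^(i ^ 2))
  (fun i j => burge (L - i) i ((a - b) * j) (b * j))).
  apply: poly_nneg_sum => i lt_iL; apply: poly_nnegM; first exact: poly_nnegXn.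
  apply: burge_pos_coprime; rewrite ?subn_gt0 //; last by lia.
  by rewrite coprime_subl // ltnW.
by move=> j; rewrite -expnMn -burge_transform_lim -mulnDl subnK // ltnW.
Qed.

(** The doubling formulas are used at [r = s * j]; their weights depend on [L] and [m] only. *)
Lemma central_posD c s e : e \in [:: 1; 2]%N -> central_pos c s ->
  central_pos (c + s ^ 2 * e) s.*2.
Proof.
move=> e12 pos L B le_LB.
have [W Wnneg HW] : exists2 W : nat -> {poly int},
    forall m, poly_nneg (W m) &
    forall r, 'X^(e * r ^ 2) * qbin L.*2 (L + r.*2)
      = \sum_(0 <= m < L.+1) W m * qbin m.*2 (m + r).
  have Wnneg m f : poly_nneg (\sum_(0 <= t < L.+1)
      'X^(f t) * qbin L (t + m.*2) * qbin (t + m.*2) m.*2).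
    apply: poly_nneg_sum => t _; apply: poly_nnegM; last exact: qbin_nneg.
    by apply: poly_nnegM; [exact: poly_nnegXn | exact: qbin_nneg].
  move: e12; rewrite !inE => /orP[] /eqP ->; eexists.
  - by move=> m; apply: (Wnneg m (fun t => m ^ 2 + L * t)%N).
  - by move=> r; rewrite mul1n qbin_double1.
  - by move=> m; apply: (Wnneg m (fun t => t ^ 2 + 2 * t * m + 2 * m ^ 2)%N).
  - by move=> r; rewrite qbin_double2.
rewrite (@theta_sum _ _ _ L.+1 _ W (fun m j => qbin m.*2 (m + s * j))).
  by apply: poly_nneg_sum => m lt_m; apply: poly_nnegM => //; apply: pos; lia.
move=> j; rewrite -HW -doubleMl; congr ('X^_ * _); rewrite expnMn; ring.
Qed.

(** Before the doubling with digit [e k] the period is $2^k s$, so this digit adds $e_k 4^k s^2$. *)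
Lemma central_pos_digits c s n (e : nat -> nat) :
  (forall k, e k \in [:: 1; 2]%N) -> central_pos c s ->
  central_pos (c + s ^ 2 * \sum_(0 <= k < n) e k * 4 ^ k) (2 ^ n * s).
Proof.
move=> e12 pos; elim: n => [|n IHn].
  by rewrite big_geq // muln0 addn0 mul1n.
have := central_posD _ _ _ (e12 n) IHn.
rewrite big_nat_recr //= mulnDr addnA (expnS 2) -[in X in _ -> X]mulnA mul2n.
have -> : ((2 ^ n * s) ^ 2 = s ^ 2 * 4 ^ n)%N by rewrite expnMn expnAC mulnC.
by rewrite -mulnA [(e n * _)%N]mulnC.
Qed.

(** * The digits of mu *)

(** Since $\frac23(4^D-1)=\sum_{k<D}2\cdot4^k$, subtracting distinct powers $4^k$ with $k<D$ lowers
    some of the digits 2 to 1. *)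
Lemma mu_digits n (abar : 'I_n.+1 -> nat)
    (habar : forall i : 'I_n.+1, (0 < i < n)%N -> (1 <= abar i)%N)
    (hlast : (2 - (n == 0) <= abar ord_max)%N) :
  exists2 e : nat -> nat, forall k, e k \in [:: 1; 2]%N &
    mu abar = (\sum_(0 <= k < dsum abar - 1) e k * 4 ^ k)%:R.
Proof.
set D := (dsum abar - 1)%N.
pose tail (i : 'I_n.+1) := (\sum_(k < n.+1 | (i <= k)%N) abar k)%N.
pose f i := (tail i - 2)%N.
(* A positive index forces [n > 0], so the last entry is at least 2 and [f] truncates nothing
   there. *)
have tail_ge2 (i : 'I_n.+1) : (0 < i)%N -> (2 <= tail i)%N.
  move=> i0; rewrite /tail (bigD1 ord_max) /=; last by rewrite -ltnS.
  have n0 : n != 0%N by have := ltn_ord i; lia.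
  by rewrite (negbTE n0) subn0 in hlast; rewrite (leq_trans hlast) ?leq_addr.
have tail_le (i : 'I_n.+1) : (tail i <= dsum abar)%N.
  by rewrite /dsum (bigID (fun k : 'I_n.+1 => (i <= k)%N)) /= leq_addr.
(* Here [0 < i < n], so [abar i] is positive and the tails drop strictly; this makes the exponents
   distinct. *)
have tail_lt (i j : 'I_n.+1) : (0 < i)%N -> (i < j)%N -> (tail j < tail i)%N.
  move=> i0 lt_ij; rewrite /tail [X in (_ < X)%N](bigD1 i) //=.
  rewrite -add1n leq_add ?habar ?i0 //=; first by have := ltn_ord j; lia.
  rewrite big_mkcond [X in (_ <= X)%N]big_mkcond leq_sum // => k _.
  case: ifP => // le_jk; rewrite ifT // (leq_trans (ltnW lt_ij) le_jk) /=.
  by apply: contraTneq le_jk => ->; rewrite -ltnNge.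
have f_inj (i j : 'I_n.+1) : (0 < i)%N -> (0 < j)%N -> f i = f j -> i = j.
  move=> i0 j0 E; apply: val_inj => /=.
  have := tail_ge2 i i0; have := tail_ge2 j j0; move: E; rewrite /f.
  have [/(tail_lt _ _ i0)|/(tail_lt _ _ j0)|//] := ltngtP i j; lia.
pose cnt (k : nat) : nat := (\sum_(i < n.+1 | (0 < i)%N) (f i == k))%N.
have cnt_le1 k : (cnt k <= 1)%N.
  have -> : cnt k = #|[pred i : 'I_n.+1 | (0 < i)%N & f i == k]|.
    by rewrite -sum1_card big_mkcondr; apply: eq_bigr => i _; case: eqP.
  apply/card_le1_eqP => i j; rewrite !inE => /andP[i0 /eqP <-] /andP[j0 /eqP E].
  exact: f_inj.
exists (fun k : nat => (2 - cnt k)%N).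
  by move=> k; have := cnt_le1 k; case: (cnt k) => [|[|]].
have cntE : (\sum_(0 <= k < D) cnt k * 4 ^ k
             = \sum_(i < n.+1 | (0 < i)%N) 4 ^ f i)%N.
  under eq_bigr => k _ do rewrite big_distrl /=.
  rewrite exchange_big /=; apply: eq_bigr => i i0.
  have lt_fD : (f i < D)%N.
    by have := tail_ge2 i i0; have := tail_le i; rewrite /f /D; lia.
  rewrite (bigD1_seq (f i)) ?mem_index_iota ?iota_uniq //= eqxx mul1n.
  by rewrite big1 ?addn0 // => k; rewrite eq_sym => /negbTE ->; rewrite mul0n.
have -> : mu abar = 2 / 3 * (4 ^+ D - 1) - (\sum_(i < n.+1 | (0 < i)%N) 4 ^ f i)%:R.
  by rewrite /mu natr_sum; congr (_ - _); apply: eq_bigr => i _; rewrite natrX.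
apply/eqP; rewrite subr_eq -natrD -cntE -big_split /=.
have -> : (\sum_(0 <= k < D) ((2 - cnt k) * 4 ^ k + cnt k * 4 ^ k)
           = 2 * \sum_(0 <= k < D) 4 ^ k)%N.
  rewrite big_distrr /=; apply: eq_bigr => k _.
  by rewrite -mulnDl subnK // (leq_trans (cnt_le1 k)).
rewrite natrM natr_sum big_mkord.
under eq_bigr => k _ do rewrite natrX.
rewrite subrX1; by apply/eqP; field.
Qed.

(** * The Laurent sum G *)

Lemma natr_bin2 (F : numFieldType) i : 'C(i, 2)%:R = i%:R * (i%:R - 1) / 2 :> F.
Proof.
elim: i => [|i IHi]; first by rewrite !mul0r.
by rewrite binS bin1 natrD IHi -natr1; field.
Qed.

Lemma gauss_central (M t : nat) :
  gauss (M%:Z - t%:Z) (M%:Z + t%:Z) = qbin M.*2 (M + t).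
Proof.
have [le_tM|lt_Mt] := leqP t M.
  rewrite subzn // -PoszD /gauss -qbinDl; congr qbin; lia.
rewrite qbin_gt; last by lia.
by have -> : M%:Z - t%:Z = Negz (t - M).-1 by lia.
Qed.

Lemma gaussZC (x y : int) : gauss x y = gauss y x.
Proof. by case: x y => [x|x] [y|y] //=; rewrite gaussC. Qed.

Lemma qshift0 (R : realType) (e : R) : qshift e 0 = 0.
Proof. by rewrite /qshift size_poly0 big_ord0. Qed.

(** The exponents in [G] turn out to be natural numbers, which reduces its coefficients to those of
    ordinary polynomials. *)
Lemma mcoeff_qshift (R : realType) (N n : nat) (p : {poly int}) :
  (qshift (N%:R : R) p)@_(n%:R) = ('X^N * p)`_n.
Proof.
rewrite /qshift raddf_sum /=.
under eq_bigr => i _ do rewrite mcoeffU -natrD eqr_nat.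
rewrite coefXnM; case: ltnP => [lt_nN|le_Nn].
  by rewrite big1 // => i _; rewrite (gtn_eqF (ltn_addr _ lt_nN)).
have [lt_p|le_p] := ltnP (n - N) (size p).
  rewrite (bigD1 (Ordinal lt_p)) //= subnKC // eqxx big1 ?addr0 // => i ne_i.
  rewrite (_ : (N + i == n)%N = false) //; apply/eqP => E.
  by move/eqP: ne_i; apply; apply: val_inj => /=; rewrite -E addKn.
rewrite nth_default // big1 // => i _.
rewrite (_ : (N + i == n)%N = false) //; apply/eqP => E.
by have := ltn_ord i; rewrite ltnNge (leq_trans le_p) // -E addKn.
Qed.

Lemma mcoeff_qshift_eq0 (R : realType) (N : nat) (e : R) (p : {poly int}) :
  (forall n : nat, e != n%:R) -> (qshift (N%:R : R) p)@_e = 0.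
Proof.
move=> ne; rewrite /qshift raddf_sum big1 //= => i _.
by rewrite mcoeffU -natrD eq_sym (negbTE (ne _)).
Qed.

Lemma qnonneg_G_theta (R : realType) (M a b D : nat) : (0 < a)%N ->
  poly_nneg (theta (a * b) M (fun j => qbin M.*2 (M + 2 ^ D * a * j))) ->
  qnonneg (G M%:Z M%:Z (b%:~R / 2%:R ^+ D : R)
    ((b%:~R + 1 / a%:~R) / 2%:R ^+ D) (2%:Z ^+ D * a)).
Proof.
move=> a0 pos e.
pose g j := qbin M.*2 (M + 2 ^ D * a * j).
(* The exponent at index [j]; as $\alpha-\beta=-1/(2^D a)$, the one at [- j] is larger by [j]. *)
pose E j := (a * b * j ^ 2 + 'C(j, 2))%N.
have aR : a%:R != 0 :> R by rewrite pnatr_eq0 -lt0n.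
have R2 : 2%:R ^+ D != 0 :> R by rewrite expf_neq0 // pnatr_eq0.
have s0 : (0 < 2 ^ D * a)%N by rewrite muln_gt0 expn_gt0.
pose K : int := 2%:Z ^+ D * a.
pose alpha : R := b%:~R / 2%:R ^+ D.
pose beta : R := (b%:~R + 1 / a%:~R) / 2%:R ^+ D.
pose F (j : int) := (-1) ^ j *: qshift
  (K%:~R * j%:~R * ((alpha + beta) * j%:~R + alpha - beta) / 2%:R)
  (gauss (M%:Z - K * j) (M%:Z + K * j)).
have KE i : 2%:Z ^+ D * a%:Z * i%:Z = (2 ^ D * a * i)%N%:Z.
  by rewrite -!natz !natrM natrX.
have FP i : F (Posz i) = (-1) ^+ i *: qshift ((E i)%:R : R) (g i).
  rewrite /F /alpha /beta /K KE gauss_central; congr (_ *: qshift _ _).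
  rewrite intrM rmorphXn /= -!pmulrn /E natrD !natrM natr_bin2.
  by field; rewrite aR R2.
have FN i : F (Negz i) = (-1) ^+ i.+1 *: qshift ((E i.+1 + i.+1)%:R : R) (g i.+1).
  rewrite /F /alpha /beta /K NegzE (mulrN (2%:Z ^+ D * a%:Z)) opprK gaussZC KE.
  rewrite gauss_central -exprnN invr_sign; congr (_ *: qshift _ _).
  rewrite intrM rmorphXn /= mulrNz -!pmulrn.
  rewrite /E natrD [(_ + _)%:R]natrD natr_bin2 !natrM.
  by field; rewrite aR R2.
have GE : G M%:Z M%:Z (b%:~R / 2%:R ^+ D : R)
    ((b%:~R + 1 / a%:~R) / 2%:R ^+ D) (2%:Z ^+ D * a)
  = \sum_(0 <= i < M.+1) F (Posz i) + \sum_(0 <= i < M) F (Negz i).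
  (* Indices from $-M$ to $M$ suffice: $K\geq1$, so for $|j|>M$ the Gaussian polynomial is 0. *)
  rewrite /G -/F -/K -/alpha -/beta
    (@fsbigE _ _ _ _ _ ([seq Posz i | i <- index_iota 0 M.+1] ++
      [seq Negz i | i <- index_iota 0 M])) //.
  - rewrite (eq_bigl xpredT) => [|j]; last by rewrite in_setT.
    by rewrite big_cat !big_map.
  - rewrite cat_uniq !map_inj_uniq ?iota_uniq ?andbT; try by move=> ? ? [].
    by apply/hasPn => j /mapP[i _ ->]; apply/mapP => -[].
  move=> j _; rewrite mem_cat negb_or => /andP[].
  case: j => i.
    rewrite mem_map ?mem_index_iota => [lt_Mi _|? ? [] //].
    rewrite -[LHS]/(F (Posz i)) FP /g qbin_gt; last by have := leq_pmull i s0; lia.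
    by rewrite qshift0 scaler0.
  move=> _; rewrite mem_map ?mem_index_iota => [lt_Mi|? ? [] //].
  rewrite -[LHS]/(F (Negz i)) FN /g qbin_gt; last by have := leq_pmull i.+1 s0; lia.
  by rewrite qshift0 scaler0.
rewrite GE raddfD !raddf_sum /=.
under eq_bigr => i _ do rewrite FP mcoeffZ.
under [X in _ + X]eq_bigr => i _ do rewrite FN mcoeffZ.
have [/natrP[n ->]|ne] := boolP (e \is a Num.nat); last first.
  have ne' (n : nat) : e != n%:R by apply: contraNneq ne => ->; exact: natr_nat.
  by rewrite !big1 ?addr0 // => i _; rewrite mcoeff_qshift_eq0 ?mulr0.
suff -> : \sum_(0 <= i < M.+1) (-1) ^+ i * (qshift ((E i)%:R : R) (g i))@_(n%:R)
    + \sum_(0 <= i < M) (-1) ^+ i.+1 *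
        (qshift ((E i.+1 + i.+1)%:R : R) (g i.+1))@_(n%:R)
  = (theta (a * b) M g)`_n by exact: pos.
(* The term [j = 0] stands alone; every other [j] is paired with [- j]. *)
rewrite /theta !(@big_nat_recl _ _ _ M) // -addrA -big_split coefD coef_sum.
have sgnC k (p : {poly int}) : (-1) ^+ k * p`_n = ((-1) ^+ k * p)`_n.
  rewrite -[in LHS]signr_odd -[in RHS]signr_odd.
  by case: (odd k); rewrite ?expr1 ?mulN1r ?coefN ?mul1r.
congr (_ + _).
  by rewrite mcoeff_qshift /kappa /E eqxx !mul1r bin_small // addn0.
apply: eq_bigr => i _ /=; rewrite !mcoeff_qshift !sgnC -coefD.
suff -> : (-1) ^+ i.+1 * ('X^(E i.+1) * g i.+1) +
    (-1) ^+ i.+1 * ('X^(E i.+1 + i.+1) * g i.+1)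
  = kappa i.+1 * 'X^(a * b * i.+1 ^ 2) * g i.+1 by [].
by rewrite /kappa /E /= !exprD; ring.
Qed.

Theorem theorem1p6 (R : realType) (n : nat) (abar : 'I_n.+1 -> nat)
    (habar : forall i : 'I_n.+1, (0 < i < n)%N -> (1 <= abar i)%N)
    (hlast : (2 - (n == 0) <= abar ord_max)%N)
    (a b : int) (hab : coprimez a b)
    (hlo : mu abar * a%:~R < b%:~R) (hhi : b%:~R < (mu abar + 1) * a%:~R)
    (M : nat) :
  qnonneg
    (G M%:Z M%:Z
       (b%:~R / 2%:R ^+ (dsum abar - 1) : R)
       ((b%:~R + 1 / a%:~R) / 2%:R ^+ (dsum abar - 1))
       (2%:Z ^+ (dsum abar - 1) * a)).
Proof.
have [e e12 muE] := mu_digits n abar habar hlast.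
move: (dsum abar - 1)%N muE => D; set m := (\sum_(_ <= _ < _) _)%N => muE.
have lo : m%:Z * a < b by rewrite -(ltr_int rat) intrM -pmulrn -muE.
have hi : b < m.+1%:Z * a.
  by rewrite -(ltr_int rat) intrM -pmulrn -natr1 -muE.
(* Otherwise $ma<b<(m+1)a$ would be impossible. *)
have a_gt0 : 0 < a by nia.
move: a_gt0 hab lo hi {hlo hhi}; case: a => // a a_gt0 hab lo hi.
(* Here $b=ma+b_0$ with $0<b_0<a$, and $b_0$ is again coprime to $a$. *)
have Eb : b = (m * a + absz (b - m%:Z * a%:Z)%R)%N%:Z by lia.
move: hab lo hi; rewrite Eb; move: (absz _) => b0 {Eb b}.
rewrite /coprimez /gcdz /= => hab lo hi.
have co : coprime a b0 by move: hab; rewrite eqz_nat gcdnMDl.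
apply: qnonneg_G_theta => //.
(* The pair $(a,b_0)$ supplies $ab_0$ with period $a$; the digits of $m$ supply $a^2m$ by
   doublings. *)
have -> : (a * (m * a + b0) = a * b0 + a ^ 2 * m)%N by nia.
apply: central_pos_digits (leqnn M) => //; apply: central_pos_base => //; nia.
Qed.
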